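(* Let $\theta$ be a $B$-action, let $(X,d_\theta)$ be a complete $\theta$-metric space and let $f:X\to X$ be a mapping such that, for some $\alpha\in[0,1)$, $$d_\theta(fx,fy)\le \alpha\, d_\theta(x,y)\quad\text{for all } x,y\in X.$$ Then $f$ has a unique fixed point.
   Context: A $B$-action is a map $\theta:[0,+\infty)\times[0,+\infty)\to[0,+\infty)$, continuous with respect to each variable, such that, with $\mathrm{Im}(\theta)=\{\theta(s,t):s,t\ge 0\}$: (I) $\theta(0,0)=0$ and $\theta(t,s)=\theta(s,t)$ for all $t,s\ge 0$; (II) $\theta(s,t)<\theta(u,v)$ whenever either $s<u$ and $t\le v$, or $s\le u$ and $t<v$; (III) for each $r\in \mathrm{Im}(\theta)\setminus\{0\}$ and each $s\in(0,r]$ there exists $t\in[0,r]$ with $\theta(t,s)=r$; (IV) $\theta(s,0)\le s$ for all $s>0$. A $\theta$-metric on a nonempty set $X$ is a map $d_\theta:X\times X\to[0,+\infty)$ such that for all $x,y,z\in X$: $d_\theta(x,y)=0$ iff $x=y$; $d_\theta(x,y)=d_\theta(y,x)$; $d_\theta(x,y)\le\theta(d_\theta(x,z),d_\theta(z,y))$. Then $(X,d_\theta)$ is called a $\theta$-metric space. For $x\in X$ and $r\in \mathrm{Im}(\theta)$ put $B_{d_\theta}(x,r)=\{y\in X: d_\theta(x,y)<r\}$. The induced topology $\tau_{d_\theta}$ on $X$ consists of all $A\subset X$ such that for every $x\in A$ there is $r\in \mathrm{Im}(\theta)\setminus\{0\}$ with $B_{d_\theta}(x,r)\subset A$. Convergence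 of sequences in $X$ is with respect to $\tau_{d_\theta}$. A sequence $\{x_n\}$ in $X$ is Cauchy if for each $\epsilon>0$ there is $N>0$ such that $d_\theta(x_n,x_m)<\epsilon$ for all $m\ge n\ge N$. The space $(X,d_\theta)$ is complete if every Cauchy sequence converges in $X$. *)

(* Defs.v *)
From HB Require Import structures.
From mathcomp Require Import all_boot all_order all_algebra.
From mathcomp Require Import all_classical all_reals all_analysis.

Set Implicit Arguments.
Unset Strict Implicit.
Unset Printing Implicit Defensive.

Import Order.TTheory GRing.Theory Num.Theory.
Import numFieldNormedType.Exports.

Local Open Scope classical_set_scope.
Local Open Scope ring_scope.

(* Maps on [0, +oo[ x [0, +oo[ are represented by maps on R x R of which only *)
(* the values at nonnegative arguments are ever constrained or used.          *)

Definition theta_im (R : realType) (theta : R -> R -> R) : set R :=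
  [set theta s t | s in `[0, +oo[ & t in `[0, +oo[].

Record b_action (R : realType) (theta : R -> R -> R) : Prop := BAction {
  b_action_ge0 : forall s t, 0 <= s -> 0 <= t -> 0 <= theta s t;
  b_action_continuousl : forall t, 0 <= t ->
    {within `[0, +oo[, continuous (fun s => theta s t)};
  b_action_continuousr : forall s, 0 <= s ->
    {within `[0, +oo[, continuous (fun t => theta s t)};
  b_action00 : theta 0 0 = 0;
  b_actionC : forall s t, 0 <= s -> 0 <= t -> theta t s = theta s t;
  b_action_lt : forall s t u v, 0 <= s -> 0 <= t -> 0 <= u -> 0 <= v ->
    (s < u /\ t <= v) \/ (s <= u /\ t < v) -> theta s t < theta u v;
  b_action_solve : forall r s, (theta_im theta `\ 0) r -> 0 < s <= r ->
    exists2 t, 0 <= t <= r & theta t s = r;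
  b_action_r0 : forall s, 0 < s -> theta s 0 <= s
}.

Record theta_metric (R : realType) (theta : R -> R -> R) (X : Type)
    (d : X -> X -> R) : Prop := ThetaMetric {
  theta_metric_nonempty : inhabited X;
  theta_metric_ge0 : forall x y, 0 <= d x y;
  theta_metric_eq0 : forall x y, d x y = 0 <-> x = y;
  theta_metricC : forall x y, d x y = d y x;
  theta_metric_triangle : forall x y z, d x y <= theta (d x z) (d z y)
}.

Definition theta_ball (R : realType) (X : Type) (d : X -> X -> R)
    (x : X) (r : R) : set X :=
  [set y | d x y < r].

Definition theta_open (R : realType) (theta : R -> R -> R) (X : Type)
    (d : X -> X -> R) : set_system X :=
  [set A | forall x, A x ->
    exists2 r, (theta_im theta `\ 0) r & theta_ball d x r `<=` A].

(* An alias of X carrying the topology whose open sets are theta_open; the   *)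
(* hypothesis on theta is only used to know that X itself is open.           *)
Definition theta_space (R : realType) (theta : R -> R -> R)
    (h : b_action theta) (X : Type) (d : X -> X -> R) : Type := X.

Section theta_topology.
Variables (R : realType) (theta : R -> R -> R) (h : b_action theta).
Variables (X : Type) (d : X -> X -> R).

Lemma theta_openT : theta_open theta d setT.
Proof.
move=> x _; exists (theta 1 0) => //; split.
  by exists 1; rewrite /= ?in_itv /= ?ler01 //; exists 0;
    rewrite /= ?in_itv /= ?lexx.
move=> /= e; have : theta 0 0 < theta 1 0.
  by apply: (b_action_lt h) => //; left.
by rewrite e (b_action00 h) ltxx.
Qed.

Lemma theta_openI : setI_closed (theta_open theta d).
Proof.
move=> A B oA oB x [/oA[r ir rA] /oB[s is_ sB]].
have [rs|sr] := leP r s.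
  exists r => // y yr; split; first exact: rA.
  by apply: sB; exact: lt_le_trans yr rs.
exists s => // y ys; split; last exact: sB.
by apply: rA; exact: lt_trans ys sr.
Qed.

Lemma theta_open_bigU (I : Type) (f : I -> set X) :
  (forall i, theta_open theta d (f i)) -> theta_open theta d (\bigcup_i f i).
Proof.
move=> of_ x [i _ /of_[r ir rf]]; exists r => // y /rf fy.
by exists i.
Qed.

HB.instance Definition _ := gen_eqMixin (theta_space h d).
HB.instance Definition _ := gen_choiceMixin (theta_space h d).
HB.instance Definition _ := @isOpenTopological.Build (theta_space h d)
  (theta_open theta d) theta_openT theta_openI theta_open_bigU.

End theta_topology.

Definition theta_cauchy (R : realType) (X : Type) (d : X -> X -> R)
    (x_ : nat -> X) : Prop :=
  forall e : R, 0 < e -> exists2 N : nat, (0 < N)%N &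
    forall n m : nat, (N <= n)%N -> (n <= m)%N -> d (x_ n) (x_ m) < e.

Definition theta_complete (R : realType) (theta : R -> R -> R)
    (h : b_action theta) (X : Type) (d : X -> X -> R) : Prop :=
  forall x_ : nat -> theta_space h d, theta_cauchy d x_ ->
    exists x : theta_space h d, x_ @ \oo --> x.

(* Main.v *)
Require Import Defs.
From HB Require Import structures.
From mathcomp Require Import all_boot all_order all_algebra.
From mathcomp Require Import all_classical all_reals all_analysis.
From mathcomp Require Import lra.

(** The orbit [x_n = f^n x_0] satisfies [d x_n x_(n+1) <= alpha^n d x_0 x_1].
    As [theta 0 (alpha e) <= alpha e < e], continuity gives [delta > 0] with
    [theta delta (alpha e) < e]; hence, as soon as [d x_n x_(n+1) <= delta], the
    ball of radius [e] around [x_n] is stable under [f] and contains the rest of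
    the orbit, which is therefore Cauchy. The same continuity estimate shows
    that balls are open and that the limit of the orbit is fixed. *)

Import Order.TTheory GRing.Theory Num.Theory.
Import numFieldNormedType.Exports.
Local Open Scope ring_scope.

Set Implicit Arguments.
Unset Strict Implicit.

Lemma b_action_le (R : realType) (theta : R -> R -> R) (h : b_action theta)
    (s t u v : R) :
  0 <= s -> 0 <= t -> s <= u -> t <= v -> theta s t <= theta u v.
Proof.
move=> s0 t0 su tv; have u0 := le_trans s0 su; have v0 := le_trans t0 tv.
move: su; rewrite le_eqVlt => /predU1P[<-|su]; last first.
  by apply/ltW/(b_action_lt h) => //; left.
move: tv; rewrite le_eqVlt => /predU1P[<-//|tv].
by apply/ltW/(b_action_lt h) => //; right.
Qed.

(** Symmetry reduces this to [b_action_r0], which covers only positive arguments; at [t = 0] the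
    value is [theta 0 0 = 0]. *)
Lemma b_action_0l (R : realType) (theta : R -> R -> R) (h : b_action theta)
    (t : R) : 0 <= t -> theta 0 t <= t.
Proof.
rewrite le_eqVlt => /predU1P[<-|t0]; first by rewrite (b_action00 h).
by rewrite (b_actionC h (ltW t0) (lexx 0)); exact: (b_action_r0 h).
Qed.

(** Since [theta 0 t <= t < e], continuity in the first variable at [0], from the right, leaves room
    for some [delta > 0]. *)
Lemma b_action_small (R : realType) (theta : R -> R -> R) (h : b_action theta)
    (t e : R) : 0 <= t < e -> exists2 delta, 0 < delta & theta delta t < e.
Proof.
move=> /andP[t0 te].
have cont := (subspace_continuousP _ _).1 (b_action_continuousl h t0).
move: (cont 0); rewrite /= in_itv /= lexx => /(_ isT)/cvgr_lt/(_ e).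
move=> /(_ (le_lt_trans (b_action_0l h t0) te)).
rewrite near_withinE => /nbhs_ballP[r /= r0 rP].
exists (r / 2); first by rewrite divr_gt0.
apply: rP; last by rewrite /= in_itv /= andbT divr_ge0// ltW.
by rewrite /ball /= sub0r normrN gtr0_norm; lra.
Qed.

(** Open sets are tested only with radii in the image of [theta]; the radius [theta e 0] makes any
    positive bound usable. *)
Lemma theta_im_small (R : realType) (theta : R -> R -> R) (h : b_action theta)
    (e : R) : 0 < e -> exists2 r, (theta_im theta `\ 0)%classic r & r <= e.
Proof.
move=> e0; exists (theta e 0); last exact: (b_action_r0 h).
split; first by exists e; rewrite /= ?in_itv /= ?(ltW e0)//; exists 0;
  rewrite /= ?in_itv /= ?lexx.
have : theta 0 0 < theta e 0 by apply: (b_action_lt h) => //; [exact: ltW|left].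
by rewrite (b_action00 h) => /[swap] /= ->; rewrite ltxx.
Qed.

Lemma theta_metricxx (R : realType) (theta : R -> R -> R) (X : Type)
    (d : X -> X -> R) (hd : theta_metric theta d) (x : X) : d x x = 0.
Proof. exact/(theta_metric_eq0 hd). Qed.

Lemma theta_metric_triangle_le (R : realType) (theta : R -> R -> R)
    (h : b_action theta) (X : Type) (d : X -> X -> R)
    (hd : theta_metric theta d) (x y z : X) (a b : R) :
  d x z <= a -> d z y <= b -> d x y <= theta a b.
Proof.
move=> da db; apply: le_trans (theta_metric_triangle hd x y z) _.
by apply: b_action_le; rewrite ?(theta_metric_ge0 hd).
Qed.

Lemma theta_ball_open (R : realType) (theta : R -> R -> R)
    (h : b_action theta) (X : Type) (d : X -> X -> R)
    (hd : theta_metric theta d) (x : X) (e : R) :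
  theta_open theta d (theta_ball d x e).
Proof.
move=> y xy.
(* A point within [delta] of [y] is at distance at most [theta delta (d x y) < e] from [x]. *)
have [|delta delta0 deltaP] := @b_action_small _ _ h (d x y) e.
  by rewrite (theta_metric_ge0 hd).
have [r rim rdelta] := theta_im_small h delta0.
exists r => // z yz; apply: le_lt_trans deltaP.
rewrite (theta_metricC hd).
apply: (theta_metric_triangle_le h hd (z := y)).
  by rewrite (theta_metricC hd) (le_trans (ltW yz)).
by rewrite (theta_metricC hd).
Qed.

Lemma theta_cvg_dist (R : realType) (theta : R -> R -> R)
    (h : b_action theta) (X : Type) (d : X -> X -> R)
    (hd : theta_metric theta d) (u : nat -> theta_space h d)
    (x : theta_space h d) :
  (u @ \oo --> x)%classic ->
  forall e, 0 < e -> (\forall n \near \oo, d x (u n) < e)%classic.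
Proof.
move=> ux e e0; apply: (ux (theta_ball d x e)).
apply: open_nbhs_nbhs; split; first exact: theta_ball_open.
by rewrite /theta_ball /= (theta_metricxx hd).
Qed.

Lemma contraction_orbit_cauchy (R : realType) (theta : R -> R -> R)
    (h : b_action theta) (X : Type) (d : X -> X -> R)
    (hd : theta_metric theta d) (f : X -> X) (alpha : R)
    (halpha : 0 <= alpha < 1)
    (hf : forall x y : X, d (f x) (f y) <= alpha * d x y) (x0 : X) :
  theta_cauchy d (fun n => iter n f x0).
Proof.
move=> e e0; have /andP[a0 a1] := halpha.
have [|delta delta0 deltaP] := @b_action_small _ _ h (alpha * e) e.
  by rewrite mulr_ge0 ?(ltW e0)//= gtr_pMl.
have step n : d (iter n f x0) (iter n.+1 f x0) <= d x0 (f x0) * alpha ^+ n.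
  elim: n => [|n IH]; first by rewrite expr0 mulr1.
  apply: le_trans (hf _ _) _.
  by rewrite exprS mulrCA ler_wpM2l.
have [N _ NP] : (\forall n \near \oo, d x0 (f x0) * alpha ^+ n < delta)%classic.
  apply: (@cvgr_lt _ _ _ _ _ 0) => //.
  by apply: (@cvg_geometric _ (d x0 (f x0)) alpha); rewrite ger0_norm.
(* The successor only serves to make the index positive; [m] becomes [(m - n) + n] for an induction
   on the gap. *)
exists N.+1 => // n m /ltnW Nn /subnK <-.
elim: (m - n)%N => [|k IH]; first by rewrite add0n (theta_metricxx hd).
apply: le_lt_trans deltaP.
(* Through [f x_n]: the first leg is one small step, and the second is the image under [f] of a
   distance already below [e], hence at most [alpha * e]. *)
apply: (theta_metric_triangle_le h hd (z := (iter n.+1 f x0))).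
  exact/(le_trans (step n))/ltW/NP.
by rewrite addSn; apply: le_trans (hf _ _) _; rewrite ler_wpM2l// ltW.
Qed.

Unset Implicit Arguments.

Theorem theorem3p1 (R : realType) (theta : R -> R -> R)
    (htheta : b_action theta) (X : Type) (d : X -> X -> R)
    (hd : theta_metric theta d) (hcomplete : theta_complete htheta d)
    (f : X -> X) (alpha : R) (halpha : 0 <= alpha < 1)
    (hf : forall x y : X, d (f x) (f y) <= alpha * d x y) :
  exists! x : X, f x = x.
Proof.
have /andP[a0 a1] := halpha.
have [x0] := theta_metric_nonempty hd.
have [x ux] := hcomplete _
  (contraction_orbit_cauchy htheta hd halpha hf x0).
have dux := theta_cvg_dist hd ux.
have fx : f x = x.
  apply/(theta_metric_eq0 hd)/le_anti/andP; split; last first.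
    exact: theta_metric_ge0 hd _ _.
  apply/ler_addgt0Pl => c c0; rewrite addr0.
  (* Passing through [x_(n+1)], it suffices that [d (f x) x_(n+1) <= d x x_n <= delta] and
     [d x_(n+1) x <= c / 2]. *)
  have [|delta delta0 deltaP] := @b_action_small _ _ htheta (c / 2) c.
    by apply/andP; split; lra.
  have [N _ NP] := dux _ delta0.
  have [M _ MP] : (\forall n \near \oo, d x (iter n f x0) < c / 2)%classic.
    by apply: dux; rewrite divr_gt0.
  pose n := maxn N M.
  apply/ltW/(le_lt_trans _ deltaP).
  apply: (theta_metric_triangle_le htheta hd (z := (iter n.+1 f x0))).
    apply: le_trans (hf _ _) _; apply: le_trans (ler_piMl _ (ltW a1)) _.
      exact: theta_metric_ge0 hd _ _.
    exact/ltW/NP/leq_maxl.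
  rewrite (theta_metricC hd); apply/ltW/MP.
  by rewrite /= (leq_trans (leq_maxr N M)).
exists x; split=> // y fy; apply/(theta_metric_eq0 hd).
(* For two fixed points, [d x y <= alpha * d x y] with [alpha < 1] excludes [d x y > 0]. *)
have := hf x y; rewrite fx fy => dxy.
have := theta_metric_ge0 hd x y; rewrite le_eqVlt => /predU1P[//|d0].
by move: dxy; rewrite leNgt gtr_pMl// a1.
Qed.
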